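(* Let $B$ be the backward shift on the complex space $\ell^2(\mathbb{N})$ and let $\Lambda \subset \mathbb{C}$ be non-empty. The set $\bigcap_{\lambda \in \Lambda}FHC(\lambda B)$ is non-empty if and only if the set $\{|\lambda|:\,\lambda \in \Lambda\}$ is a countable relatively compact non-empty subset of $(1,+\infty)$.
   Context: $\mathbb{N}=\{0,1,2,\ldots\}$. The backward shift is $B(x_0,x_1,x_2,\ldots)=(x_1,x_2,x_3,\ldots)$. For a continuous linear operator $T$ on a space $X$, $FHC(T)$ is the set of frequently hypercyclic vectors of $T$: those $x\in X$ such that for every non-empty open $U\subset X$, $\underline{d}(\{n\in\mathbb{N}:T^n(x)\in U\})>0$, where $\underline{d}(E)=\liminf_{n\to\infty}\frac{\mathrm{card}([0,n]\cap E)}{n+1}$. A subset of an open interval $I$ is relatively compact in $I$ if its closure is a compact subset of $I$. Countable means finite or countably infinite. *)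

(* Defs.v *)
From HB Require Import structures.
Set Warnings "-notation-overridden,-ambiguous-paths,-notation-incompatible-prefix,-redundant-canonical-projection,-projection-no-head-constant".
From mathcomp Require Import all_boot all_order all_algebra.
From mathcomp Require Import ring.
From mathcomp Require Import complex.
From mathcomp Require Import all_classical all_reals all_analysis.

Set Implicit Arguments.
Unset Strict Implicit.
Unset Printing Implicit Defensive.

Import Order.TTheory GRing.Theory Num.Theory.
Import numFieldNormedType.Exports.

Local Open Scope classical_set_scope.
Local Open Scope ring_scope.

(* [normc z : R] is the real-valued modulus of the library, whereas [`|z|] has
   type [R[i]]. *)
Notation normc := ComplexField.Normc.normc.

Section SquareSums.
Variable R : realType.
Implicit Types (x y : nat -> R[i]) (a : R[i]).

Definition sq_terms x : R^nat := fun n => normc (x n) ^+ 2.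

Definition l2_sum x : R := limn (series (sq_terms x)).

Definition l2_pred : {pred nat -> R[i]} :=
  fun x => `[< cvgn (series (sq_terms x)) >].

Lemma l2_predP x : reflect (cvgn (series (sq_terms x))) (x \in l2_pred).
Proof. exact: asboolP. Qed.

Lemma sq_terms_ge0 x n : 0 <= sq_terms x n.
Proof. exact: sqr_ge0. Qed.

Lemma normc_ge0 (z : R[i]) : 0 <= normc z.
Proof. by case: z => a b; exact: sqrtr_ge0. Qed.

Lemma sq_termsZ a x : sq_terms (a *: x) = normc a ^+ 2 *: sq_terms x.
Proof.
apply/funext => n.
rewrite /sq_terms /= [(_ *: x) n]/(a * x n) ComplexField.Normc.normcM exprMn.
by [].
Qed.

Lemma sq_termsD x y (c : R) n : 0 < c ->
  sq_terms (x + y) n <= ((1 + c) *: sq_terms x + (1 + c^-1) *: sq_terms y) n.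
Proof.
move=> c0; rewrite /sq_terms /= [(x + y) n]/(x n + y n).
rewrite [leRHS]/((1 + c) * normc (x n) ^+ 2 + (1 + c^-1) * normc (y n) ^+ 2).
have := le_normcD (x n) (y n).
have := normc_ge0 (x n + y n); have := normc_ge0 (x n); have := normc_ge0 (y n).
move: (normc (y n)) (normc (x n)) (normc (x n + y n)) => u v w u0 v0 w0 wuv.
apply: (@le_trans _ _ ((v + u) ^+ 2)); first by rewrite !expr2; apply: ler_pM.
rewrite -subr_ge0.
have -> : (1 + c) * v ^+ 2 + (1 + c^-1) * u ^+ 2 - (v + u) ^+ 2
   = c^-1 * (c * v - u) ^+ 2.
  by field; rewrite gt_eqF.
by rewrite mulr_ge0 ?sqr_ge0 // invr_ge0 ltW.
Qed.

Lemma cvg_sq_termsZ a x : x \in l2_pred ->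
  cvgn (series (sq_terms (a *: x))).
Proof. by move=> /l2_predP cx; rewrite sq_termsZ; exact: is_cvg_seriesZ. Qed.

Lemma cvg_sq_comb x y (c d : R) : x \in l2_pred -> y \in l2_pred ->
  cvgn (series (c *: sq_terms x + d *: sq_terms y)).
Proof.
by move=> /l2_predP cx /l2_predP cy; apply: is_cvg_seriesD; exact: is_cvg_seriesZ.
Qed.

Lemma l2_predD x y : x \in l2_pred -> y \in l2_pred -> x + y \in l2_pred.
Proof.
move=> lx ly; apply/l2_predP.
have le_xy n : sq_terms (x + y) n <= ((1 + 1) *: sq_terms x + (1 + 1^-1) *: sq_terms y) n.
  exact: sq_termsD.
apply: (series_le_cvg (sq_terms_ge0 _) _ le_xy); last exact: cvg_sq_comb.
by move=> n; apply: le_trans (le_xy n); exact: sq_terms_ge0.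
Qed.

Lemma l2_predZ a x : x \in l2_pred -> a *: x \in l2_pred.
Proof. by move=> lx; apply/l2_predP; exact: cvg_sq_termsZ. Qed.

Lemma l2_pred0 : 0 \in l2_pred.
Proof.
apply/l2_predP; have -> : sq_terms 0 = 0.
  apply/funext => n; rewrite /sq_terms [X in normc X](_ : _ = 0) //.
  by rewrite ComplexField.Normc.normc0 expr0n.
have -> : series (0 : R^nat) = cst 0.
  by apply/funext => n; rewrite /series /= big1.
exact: is_cvg_cst.
Qed.

Lemma l2_submod_closed : submod_closed l2_pred.
Proof.
split; first exact: l2_pred0.
by move=> a x y lx ly; exact: l2_predD (l2_predZ _ lx) ly.
Qed.

Lemma nd_series_sq x : nondecreasing_seq (series (sq_terms x)).
Proof.
apply/nondecreasing_seqP => n; rewrite seriesSr lerDl; exact: sq_terms_ge0.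
Qed.

Lemma l2_sum_ge0 x : x \in l2_pred -> 0 <= l2_sum x.
Proof.
move=> /l2_predP cx.
have := nondecreasing_cvgn_le (nd_series_sq x) cx 0%N.
by rewrite /series /= big_nil.
Qed.

Lemma sq_terms_le_sum x n : x \in l2_pred -> sq_terms x n <= l2_sum x.
Proof.
move=> /l2_predP cx.
apply: le_trans (nondecreasing_cvgn_le (nd_series_sq x) cx n.+1).
rewrite seriesSr lerDr /series /=; apply: sumr_ge0 => i _; exact: sq_terms_ge0.
Qed.

Lemma l2_sumZ a x : x \in l2_pred ->
  l2_sum (a *: x) = normc a ^+ 2 * l2_sum x.
Proof. by move=> /l2_predP cx; rewrite /l2_sum sq_termsZ lim_seriesZ. Qed.

Lemma l2_sum0_eq0 x : x \in l2_pred -> l2_sum x = 0 -> x = 0.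
Proof.
move=> lx x0; apply/funext => n.
have := sq_terms_le_sum n lx; rewrite x0 => le0.
have /eqP : sq_terms x n == 0 by rewrite eq_le le0 sq_terms_ge0.
by move/eqP; rewrite sqrf_eq0 => /eqP/ComplexField.Normc.eq0_normc.
Qed.

Lemma l2_sumD x y (c : R) : 0 < c -> x \in l2_pred -> y \in l2_pred ->
  l2_sum (x + y) <= (1 + c) * l2_sum x + (1 + c^-1) * l2_sum y.
Proof.
move=> c0 lx ly.
have /l2_predP cxy := l2_predD lx ly.
have /l2_predP cx := lx; have /l2_predP cy := ly.
have -> : (1 + c) * l2_sum x + (1 + c^-1) * l2_sum y =
    limn (series ((1 + c) *: sq_terms x + (1 + c^-1) *: sq_terms y)).
  rewrite lim_seriesD; [|exact: is_cvg_seriesZ|exact: is_cvg_seriesZ].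
  by rewrite !lim_seriesZ.
apply: ler_lim => //; first exact: cvg_sq_comb.
near=> n; rewrite /series /=; apply: ler_sum => i _; exact: sq_termsD.
Unshelve. all: by end_near. Qed.

Lemma l2_minkowski x y : x \in l2_pred -> y \in l2_pred ->
  Num.sqrt (l2_sum (x + y)) <= Num.sqrt (l2_sum x) + Num.sqrt (l2_sum y).
Proof.
move=> lx ly; have lxy := l2_predD lx ly.
have x0 := l2_sum_ge0 lx; have y0 := l2_sum_ge0 ly.
have [ex|nx] := eqVneq (l2_sum x) 0.
  by rewrite (l2_sum0_eq0 lx ex) add0r lerDr sqrtr_ge0.
have [ey|ny] := eqVneq (l2_sum y) 0.
  by rewrite (l2_sum0_eq0 ly ey) addr0 lerDl sqrtr_ge0.
set a := Num.sqrt (l2_sum x); set b := Num.sqrt (l2_sum y).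
have a0 : 0 < a by rewrite sqrtr_gt0 lt_neqAle eq_sym nx.
have b0 : 0 < b by rewrite sqrtr_gt0 lt_neqAle eq_sym ny.
have ab0 : 0 <= a + b by rewrite addr_ge0 // ltW.
rewrite -(@ger0_norm _ (a + b)) // -sqrtr_sqr ler_wsqrtr //.
have := @l2_sumD x y (b / a) (divr_gt0 b0 a0) lx ly.
rewrite -[l2_sum x]sqr_sqrtr // -[l2_sum y]sqr_sqrtr // -/a -/b => /le_trans.
apply; rewrite le_eqVlt; apply/orP; left; apply/eqP. field.
by rewrite !gt_eqF.
Qed.

End SquareSums.

HB.instance Definition _ (R : realType) :=
  GRing.isSubmodClosed.Build R[i] (nat -> R[i]) (@l2_pred R)
    (@l2_submod_closed R).

Record l2 (R : realType) := L2 {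
  l2_val :> nat -> R[i] ;
  l2_valP : l2_val \in @l2_pred R }.

Section L2Space.
Variable R : realType.
Implicit Types x y : l2 R.

HB.instance Definition _ := [isSub for @l2_val R].
HB.instance Definition _ := [Choice of l2 R by <:].
HB.instance Definition _ := [SubChoice_isSubLmodule of l2 R by <:].

(* The norms of a [normedModType R[i]] take their values in [R[i]]. *)
Definition l2_norm x : R[i] := (Num.sqrt (l2_sum x))%:C%C.

Lemma l2_normD x y : l2_norm (x + y) <= l2_norm x + l2_norm y.
Proof.
by rewrite /l2_norm -rmorphD /= lecR; apply: l2_minkowski; exact: l2_valP.
Qed.

Lemma l2_normZ (a : R[i]) x : l2_norm (a *: x) = `|a| * l2_norm x.
Proof.
rewrite /l2_norm; have -> : l2_val (a *: x) = a *: l2_val x by [].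
rewrite l2_sumZ ?l2_valP // sqrtrM ?sqr_ge0 // sqrtr_sqr ger0_norm ?normc_ge0 //.
by rewrite rmorphM.
Qed.

Lemma l2_norm0_eq0 x : l2_norm x = 0 -> x = 0.
Proof.
move=> /complexI /eqP; rewrite sqrtr_eq0 => x0.
apply: val_inj; apply: l2_sum0_eq0; first exact: l2_valP.
by apply/eqP; rewrite eq_le x0 l2_sum_ge0 // l2_valP.
Qed.

HB.instance Definition _ :=
  Lmodule_isNormed.Build R[i] (l2 R) l2_normD l2_normZ l2_norm0_eq0.

Lemma shift_series_le x n :
  series (sq_terms (fun k => x k.+1)) n <= l2_sum x.
Proof.
have /l2_predP cx := l2_valP x.
apply: le_trans (nondecreasing_cvgn_le (nd_series_sq x) cx n.+1).
rewrite !seriesEnat /= [leRHS]big_nat_recl //= lerDr; exact: sq_terms_ge0.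
Qed.

Lemma shift_l2P x : (fun n => x n.+1) \in @l2_pred R.
Proof.
apply/l2_predP; apply: nondecreasing_is_cvgn; first exact: nd_series_sq.
by exists (l2_sum x) => _ [n _ <-]; exact: shift_series_le.
Qed.

Definition backward_shift x : l2 R := L2 (shift_l2P x).

Lemma shift_linear : linear backward_shift.
Proof. by move=> a x y; exact: val_inj. Qed.

HB.instance Definition _ :=
  GRing.isLinear.Build R[i] (l2 R) (l2 R) _ backward_shift shift_linear.

Lemma shift_contracting x : `|backward_shift x| <= `|x|.
Proof.
rewrite [leLHS]/(l2_norm _) [leRHS]/(l2_norm _) /l2_norm lecR ler_wsqrtr //.
apply: limr_le; first by have /l2_predP := shift_l2P x.
by apply: nearW => n; exact: shift_series_le.
Qed.

Lemma continuous_shift : continuous (backward_shift : l2 R -> l2 R).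
Proof.
apply: bounded_linear_continuous; apply/linear_boundedP.
near=> r => x; apply: le_trans (shift_contracting x) _.
by rewrite ler_peMl.
Unshelve. all: by end_near. Qed.

Lemma continuous_scale_shift (a : R[i]) :
  continuous (a \*: backward_shift : l2 R -> l2 R).
Proof.
by move=> x; apply: (@cvgZl_tmp _ _ _ (nbhs x)); exact: continuous_shift.
Qed.

End L2Space.

Definition lower_density (R : realType) (E : set nat) : \bar R :=
  limn_einf (fun n => (#|[pred k : 'I_n.+1 | `[< E k >]]|%:R / n.+1%:R)%:E).

(* [R] is only the real field in which the lower density is computed. *)
Definition FHC (R : realType) (X : topologicalType) (T : X -> X) : set X :=
  [set x | forall U : set X, open U -> U !=set0 ->
     (0 < lower_density R [set n | U (iter n T x)])%E].

Definition relatively_compact_in (X : topologicalType) (I A : set X) : Prop :=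
  compact (closure A) /\ closure A `<=` I.

(* Main.v *)
Require Import Defs.
Set Warnings "-notation-overridden,-ambiguous-paths,-notation-incompatible-prefix".
From mathcomp Require Import all_boot all_order all_algebra.
From mathcomp Require Import complex.
From mathcomp Require Import all_classical all_reals all_analysis.
From mathcomp Require Import zify ring lra.

Set Implicit Arguments.
Unset Strict Implicit.
Unset Printing Implicit Defensive.

Import Order.TTheory GRing.Theory Num.Theory.
Import numFieldNormedType.Exports.

Local Open Scope classical_set_scope.
Local Open Scope ring_scope.

(** The behaviour of all the multiples [lambda B] on one vector [x] is visible
    on the sizes of its coordinates.

    Necessity.  When [lambda ^+ n * B^n x] is within 1 of twice the first basis
    vector, the integer [n] is a peak of [x] for the radius [r] equal to the
    modulus of [lambda]: the coordinate [x n] has size about [r ^- n], while all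
    later coordinates are smaller than [r ^- n].  Frequent hypercyclicity gives
    the peaks for [r] a positive lower density.  A peak [n] for [s] followed by
    a peak [m] for [r] forces [s ^+ n < r ^+ m].  As the peaks for one fixed
    radius [r] recur within a bounded factor [k], every other radius [s]
    satisfies [s <= r ^+ k] and [r <= s ^+ k] ([peaks_moduli_close]), whence
    relative compactness in the interval from 1 to infinity.  Peaks for two
    different radii are eventually disjoint, so at most [c] radii have peaks that
    eventually fill a proportion 1/c ([size_peaks]), whence countability.

    Sufficiency.  Suppose that the radii form a sequence with values between
    [q ^+ 3] and [q ^+ E], where [q > 1].  The half-line is cut into the
    intervals from [D^j] to [D^(j+1)] with [D > 2 E].  Each interval is devoted
    to a single pattern: a radius [r], a finitely supported target [y], a finite
    list of phases and a spacing [N].  In the first part of the interval, copies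
    of [y] scaled by [r ^- n] and by the successive phases are put at the
    multiples [n] of [N].  The ratio [D] is so large that the later intervals,
    although they serve other radii, stay negligible after multiplication by
    [r ^+ n] ([hit_estimate]); it is here that the radii have to be bounded and
    bounded away from 1.  A given pattern returns after a bounded number of
    intervals, hence with positive lower density ([dense_at_rate_blocks]).

    The phases make the vector work for all [lambda] of modulus [r] at once,
    although there may be uncountably many of them: there is a finite list such
    that, whatever the argument of [lambda] and the starting point, some entry
    of the list compensates the rotation up to a small error ([phase_word]). *)

(** * Sets of positive lower density *)

Definition hits (E : set nat) (T : nat) : nat :=
  (\sum_(k < T.+1) `[< E k >])%N.

(** The proportion of [E] in initial segments is eventually at least [1 / c];
    the witness [c] keeps counting arguments within the natural numbers. *)
Definition dense_at_rate (E : set nat) (c : nat) : Prop :=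
  exists T0, forall T, (T0 <= T)%N -> (T.+1 <= c * hits E T)%N.

Lemma card_hits (E : set nat) T :
  #|[pred k : 'I_T.+1 | `[< E k >]]| = hits E T.
Proof. by rewrite /hits -sum1_card big_mkcond. Qed.

Lemma lower_density_gt0P (R : realType) (E : set nat) :
  (0 < lower_density R E)%E <-> exists c, dense_at_rate E c.
Proof.
rewrite /lower_density limn_einf_lim; set u := fun n => _.
have -> : limn (einfs u) = ereal_sup (range (einfs u)).
  by apply: cvg_lim => //; exact: cvg_einfs_sup.
split.
- move=> /ereal_sup_gt[_ [T0 _ <-]]; set l := einfs u T0 => l0.
  have lu T : (T0 <= T)%N -> (l <= u T)%E.
    by move=> leT; apply: ereal_inf_lbound; exists T.
  have [d d0 dl] : exists2 d : R, 0 < d & (d%:E <= l)%E.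
    case: l l0 lu => [d||] //.
    + by rewrite lte_fin => d0 _; exists d.
    + by move=> _ /(_ T0 (leqnn _)).
  exists (Num.truncn d^-1).+1; exists T0 => T leT.
  have := le_trans dl (lu T leT); rewrite /u card_hits lee_fin.
  rewrite ler_pdivlMr ?ltr0Sn // => dT.
  have dc : 1 <= d * (Num.truncn d^-1).+1%:R.
    by rewrite mulrC -ler_pdivrMr // mul1r ltW // truncnS_gt.
  rewrite -(ler_nat R) natrM.
  apply: le_trans (ler_wpM2l (ler0n _ _) dT).
  by rewrite mulrA [_ * d]mulrC ler_peMl.
- move=> [c [T0 H]].
  have c0 : (0 < c)%N by case: c H => // /(_ T0 (leqnn _)); rewrite mul0n.
  apply: (@lt_le_trans _ _ (c%:R^-1)%:E).
    by rewrite lte_fin invr_gt0 ltr0n.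
  apply: le_ereal_sup_tmp; exists (einfs u T0); first by exists T0.
  apply: le_ereal_inf_tmp => _ [T /= leT <-].
  rewrite /u card_hits lee_fin ler_pdivlMr ?ltr0Sn // mulrC ler_pdivrMr ?ltr0n //.
  by rewrite -natrM ler_nat mulnC H.
Qed.

Lemma dense_at_rate_sub (E F : set nat) c : E `<=` F ->
  dense_at_rate E c -> dense_at_rate F c.
Proof.
move=> EF [T0 H]; exists T0 => T /H /leq_trans; apply; rewrite leq_mul2l.
apply/orP; right; apply: leq_sum => k _.
by case: asboolP => // /EF Fk; rewrite asboolT.
Qed.

(** A set without elements in the interval from [T + 1] to [2 c T] has at most
    [T + 1] elements up to [2 c T], too few for its rate. *)
Lemma dense_at_rate_windows (E : set nat) c : dense_at_rate E c ->
  exists k T0, [/\ (0 < k)%N, (0 < T0)%N & forall T, (T0 <= T)%N ->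
    exists2 m, (T < m <= k * T)%N & E m].
Proof.
move=> [T0 H].
have c0 : (0 < c)%N by case: c H => // /(_ T0 (leqnn _)); rewrite mul0n.
exists (c * 2)%N, T0.+1; split=> //; first by rewrite muln_gt0 c0.
move=> T leT; apply: contrapT => noE.
have hT : (hits E (c * 2 * T) <= T.+1)%N.
  rewrite /hits -(big_mkord xpredT (fun k => nat_of_bool `[< E k >])).
  rewrite (@big_cat_nat _ _ _ T.+1) //=; last by nia.
  rewrite [X in (_ + X)%N]big_nat [X in (_ + X)%N]big1 => [|m mT].
    rewrite addn0 -[leqRHS]subn0 -[leqRHS]muln1 -sum_nat_const_nat.
    by apply: leq_sum => k _; case: `[< _ >].
  by apply/eqP; rewrite eqb0; apply/asboolPn => Em; apply: noE; exists m.
have := H (c * 2 * T)%N; nia.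
Qed.

Lemma window_hits (E : set nat) (P a n : nat) :
  (forall i, (a <= i < a + n)%N ->
     exists2 m, (P * i <= m < P * i.+1)%N & E m) ->
  (n <= \sum_(P * a <= m < P * (a + n)) `[< E m >])%N.
Proof.
elim: n => [|n IH] H; first by rewrite addn0.
rewrite (@big_cat_nat _ _ _ (P * (a + n))%N) /=; [|by nia|by nia].
rewrite -[leqLHS]addn1; apply: leq_add.
  by apply: IH => i Hi; apply: H; lia.
have [|m /andP[m1 m2] Em] := H (a + n)%N; first by lia.
rewrite (addnS a) (bigD1_seq m) /=; [|by rewrite mem_index_iota m1|exact: iota_uniq].
by rewrite asboolT.
Qed.

(** The windows inside the interval from [D^j] to [2 D^j] contribute about
    [D^j / P] elements, and for a suitable [j] the number [D^j] is at least a
    fixed fraction of [T], since the indices [j] have bounded gaps. *)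
Lemma dense_at_rate_blocks (E : set nat) (P D per j0 : nat) :
  (0 < P)%N -> (1 < D)%N ->
  (forall J, (j0 <= J)%N -> exists2 j, (J <= j < J + per)%N &
     forall i, (D ^ j <= P * i)%N -> (P * i.+1 <= 2 * D ^ j)%N ->
       exists2 m, (P * i <= m < P * i.+1)%N & E m) ->
  exists c, dense_at_rate E c.
Proof.
move=> P0 D1 H.
exists (D ^ (per.+2) * (4 * P))%N, (D ^ (j0 + per + 1 + 4 * P))%N => T leT.
have T0 : (0 < T)%N by apply: leq_trans leT; rewrite expn_gt0 (ltnW D1).
have := trunc_log_bounds D1 T0; set t := trunc_log D T => /andP[t1 t2].
have tj : (j0 + per + 1 + 4 * P <= t)%N.
  by rewrite -ltnS -(ltn_exp2l _ _ D1) (leq_ltn_trans leT).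
(* This index makes [2 * D ^ j <= T] while [T < D ^ per.+2 * D ^ j]. *)
have [|j /andP[j1 j2] Hj] := H (t - per.+1)%N; first by lia.
set A := (D ^ j)%N in Hj.
have PA : (4 * P <= A)%N.
  by apply: leq_trans (ltnW (ltn_expl _ D1)) _; rewrite leq_exp2l //; lia.
have TA : (T < D ^ per.+2 * A)%N.
  by apply: leq_trans t2 _; rewrite /A -expnD leq_exp2l //; lia.
have AT : (2 * A <= T)%N.
  apply: leq_trans t1; apply: (@leq_trans (D ^ j.+1)%N).
    by rewrite expnS leq_mul2r D1 orbT.
  by rewrite leq_exp2l //; lia.
pose a := (A %/ P).+1; pose n := (A %/ P - 2)%N.
have w4 : (4 <= A %/ P)%N by rewrite leq_divRL.
have wA : (P * (A %/ P) <= A)%N by rewrite mulnC leq_divM.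
have Aw : (A <= P * a)%N by rewrite mulnC ltnW // ltn_ceil.
have nA : (A <= 4 * P * n)%N.
  by apply: leq_trans Aw _; rewrite (mulnC 4) -mulnA leq_mul2l /a /n; lia.
have n2 : (P * (a + n) <= 2 * A)%N.
  apply: (@leq_trans (P * (2 * (A %/ P)))%N); last by lia.
  by rewrite leq_mul2l /a /n; lia.
have le_n : (n <= \sum_(P * a <= m < P * (a + n)) `[< E m >])%N.
  apply: window_hits => i /andP[ai ia]; apply: Hj.
    by apply: leq_trans Aw _; rewrite leq_mul2l ai orbT.
  by apply: leq_trans n2; rewrite leq_mul2l ia orbT.
have le_h : (n <= hits E T)%N.
  apply: leq_trans le_n _.
  rewrite /hits -(big_mkord xpredT (fun k => nat_of_bool `[< E k >])).
  rewrite (@big_cat_nat _ _ _ (P * a)%N 0 T.+1) //=; last by lia.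
  rewrite (@big_cat_nat _ _ _ (P * (a + n))%N (P * a) T.+1) //=; [|by lia|by lia].
  lia.
apply: leq_trans TA _; rewrite -mulnA leq_mul2l; apply/orP; right.
by apply: leq_trans nA _; rewrite leq_mul2l le_h orbT.
Qed.

(** * Powers of reals and moduli of complex numbers *)

Section Powers.
Variable R : realType.
Implicit Types (u w lambda : R[i]) (r q : R).

Lemma bernoulli (t : R) n : 0 <= t -> 1 + n%:R * t <= (1 + t) ^+ n.
Proof.
move=> t0; elim: n => [|n IH]; first by rewrite mul0r addr0 expr0.
rewrite exprS; apply: le_trans (ler_wpM2l _ IH); last by lra.
by rewrite -natr1; have := mulr_ge0 (ler0n R n) (sqr_ge0 t); rewrite expr2; lra.
Qed.

Lemma expr_unbounded q (B : R) : 1 < q -> exists n0, forall n, (n0 <= n)%N -> B <= q ^+ n.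
Proof.
move=> q1; have q0 : 0 <= q - 1 by lra.
exists (Num.truncn (B / (q - 1))).+1 => n n0.
have ber : 1 + n%:R * (q - 1) <= q ^+ n.
  by have := bernoulli n q0; rewrite (addrC 1 (q - 1)) subrK.
apply: le_trans ber.
have : B <= n%:R * (q - 1).
  rewrite -ler_pdivrMr; last lra.
  by apply: le_trans (ltW (truncnS_gt _)) _; rewrite ler_nat.
lra.
Qed.

Lemma root_gt1 r k : (0 < k)%N -> 1 < r -> exists2 q, 1 < q & q ^+ k = r.
Proof.
move=> k0 r1; have r0 := lt_trans ltr01 r1; exists (r `^ k%:R^-1).
  have k1 : 0 < k%:R^-1 :> R by rewrite invr_gt0 ltr0n.
  have n1 : (1 : R) \is Num.nneg by rewrite nnegrE.
  have nr : r \is Num.nneg by rewrite nnegrE ltW.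
  by have := gt0_ltr_powR k1 n1 nr r1; rewrite powR1.
rewrite -powR_mulrn ?powR_ge0 // -powRrM mulVf ?pnatr_eq0 -?lt0n //.
by rewrite powRr1 // ltW.
Qed.

Lemma normcX lambda n : normc (lambda ^+ n) = normc lambda ^+ n.
Proof.
elim: n => [|n IH]; first by rewrite !expr0 ComplexField.Normc.normc1.
by rewrite !exprS ComplexField.Normc.normcM IH.
Qed.

Lemma normc_nat k : normc (k%:R : R[i]) = k%:R.
Proof.
rewrite -[k%:R]/((1 : R[i]) *+ k) normcMn ComplexField.Normc.normc1.
by [].
Qed.

Lemma normc_real (a : R) : normc (a%:C%C) = `|a|.
Proof. by rewrite /= expr0n /= addr0 sqrtr_sqr. Qed.

Lemma normc_le_ReIm (a b : R) : normc (a +i* b)%C <= `|a| + `|b|.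
Proof.
rewrite -[leRHS]ger0_norm ?addr_ge0 // -sqrtr_sqr ler_wsqrtr //.
rewrite sqrrD !real_normK ?num_real //.
have : 0 <= `|a| * `|b| *+ 2 by rewrite mulrn_wge0 // mulr_ge0.
lra.
Qed.

Lemma normcB w1 w2 : normc (w1 - w2) = normc (w2 - w1).
Proof. by rewrite -normcN opprB. Qed.

Lemma normc_pow1 u n : normc u = 1 -> normc (u ^+ n) = 1.
Proof. by move=> u1; rewrite normcX u1 expr1n. Qed.

Lemma normc_pow_sub1 u n : normc u = 1 -> normc (u ^+ n - 1) <= n%:R * normc (u - 1).
Proof.
move=> u1; elim: n => [|n IH]; first by rewrite expr0 subrr ComplexField.Normc.normc0 mul0r.
have -> : u ^+ n.+1 - 1 = u * (u ^+ n - 1) + (u - 1).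
  by rewrite exprS mulrBr mulr1 addrA subrK.
apply: le_trans (le_normcD _ _) _.
rewrite ComplexField.Normc.normcM u1 mul1r -natr1 mulrDl mul1r; lra.
Qed.

End Powers.

(** * Balls and geometric decay in the sequence space *)

Section L2Facts.
Variable R : realType.
Implicit Types (v w x : l2 R) (z : nat -> R[i]).

(** The norm with values in [R] instead of [R[i]]. *)
Definition l2n x : R := Num.sqrt (l2_sum x).

Lemma l2_normE x : `|x| = (l2n x)%:C%C.
Proof. by []. Qed.

Lemma open_l2_ball (U : set (l2 R)) v : open U -> U v ->
  exists2 e : R, 0 < e & forall w, l2n (w - v) < e -> U w.
Proof.
move=> oU Uv; have /nbhs_ballP[[e f] /= e0 eU] := open_nbhs_nbhs (conj oU Uv).
move: e0; rewrite ltcE /= => /andP[/eqP f0 e0]; rewrite {}f0 in eU.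
exists e => // w wv; apply: eU; rewrite -ball_normE /= distrC.
by rewrite l2_normE ltcR.
Qed.

Lemma l2_ball_open v (e : R) : open [set w | l2n (w - v) < e].
Proof.
have -> : [set w | l2n (w - v) < e] = (fun w => `|w - v|) @^-1` [set c : R[i] | c < e%:C%C].
  by apply/seteqP; split=> w /=; rewrite l2_normE ltcR.
rewrite openE => w /=.
rewrite l2_normE ltcR => we.
apply/nbhs_ballP; exists ((e - l2n (w - v))%:C)%C => /=.
  by rewrite ltcR subr_gt0.
move=> y; rewrite -ball_normE /= => wy.
rewrite (_ : y - v = (w - v) - (w - y)); last by rewrite opprB [RHS]addrC addrA subrK.
apply: le_lt_trans (ler_normB _ _) _.
by rewrite -ltrBrDl; apply: lt_le_trans wy _; rewrite rmorphB.
Qed.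

Lemma l2n_triangle (u v w : l2 R) : l2n (u - w) <= l2n (u - v) + l2n (v - w).
Proof.
have -> : u - w = (u - v) + (v - w) by rewrite addrA subrK.
by apply: l2_minkowski; exact: l2_valP.
Qed.

Lemma normc_le_l2n x k : normc (x k) <= l2n x.
Proof.
rewrite /l2n -[leLHS]ger0_norm ?normc_ge0 // -sqrtr_sqr ler_wsqrtr //.
exact: sq_terms_le_sum (l2_valP x).
Qed.

Lemma iter_shiftE (lambda : R[i]) n x k :
  iter n (lambda \*: @backward_shift R) x k = lambda ^+ n * x (n + k)%N.
Proof.
elim: n k => [|n IH] k; first by rewrite mul1r.
rewrite iterS [LHS]/(lambda * iter n (lambda \*: @backward_shift R) x k.+1) IH.
rewrite addnS exprS; exact: mulrA.
Qed.

(** The norm of the sequence [k |-> q ^- k]. *)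
Definition decay_const (q : R) : R := Num.sqrt (1 - q ^- 2)^-1.

Lemma decay_const_ge0 q : 0 <= decay_const q.
Proof. exact: sqrtr_ge0. Qed.

Lemma decay_sum z (q d : R) : 1 < q ->
  (forall k, normc (z k) * q ^+ k <= d) ->
  cvgn (series (sq_terms z)) /\ l2_sum z <= d ^+ 2 * (1 - q ^- 2)^-1.
Proof.
move=> q1 zd; have q0 : 0 < q by apply: lt_trans q1.
have Q1 : `|q ^- 2| < 1.
  by rewrite ger0_norm ?invr_ge0 ?exprn_ge0 ?ltW // invf_lt1 ?exprn_gt0 ?exprn_egt1.
have le_z n : sq_terms z n <= geometric (d ^+ 2) (q ^- 2) n.
  rewrite /sq_terms /= (_ : (q ^- 2) ^+ n = (q ^- n) ^+ 2); last first.
    by rewrite -!exprVn -!exprM mulnC.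
  rewrite -exprMn lerXn2r ?nnegrE ?normc_ge0 //.
    apply: mulr_ge0; last by rewrite invr_ge0 exprn_ge0 // ltW.
    by apply: le_trans (zd n); rewrite mulr_ge0 ?normc_ge0 ?exprn_ge0 // ltW.
  by rewrite ler_pdivlMr ?exprn_gt0.
have cz := series_le_cvg (@sq_terms_ge0 R z) _ le_z
             (cvgP _ (cvg_geometric_series Q1)).
split; first by apply: cz => n; apply: le_trans (le_z n); exact: sq_terms_ge0.
have <- : limn (series (geometric (d ^+ 2) (q ^- 2))) = d ^+ 2 * (1 - q ^- 2)^-1.
  by apply: cvg_lim => //; exact: cvg_geometric_series.
apply: ler_lim.
- by apply: cz => n; apply: le_trans (le_z n); exact: sq_terms_ge0.
- exact: cvgP (cvg_geometric_series Q1).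
- by apply: nearW => n; rewrite /series /=; apply: ler_sum.
Qed.

Lemma decay_l2 z (q d : R) : 1 < q ->
  (forall k, normc (z k) * q ^+ k <= d) -> z \in @l2_pred R.
Proof. by move=> q1 zd; apply/l2_predP; have [] := decay_sum q1 zd. Qed.

Lemma decay_l2n x (q d : R) : 1 < q ->
  (forall k, normc (x k) * q ^+ k <= d) -> l2n x <= d * decay_const q.
Proof.
move=> q1 xd; have [_ le_x] := decay_sum q1 xd.
have d0 : 0 <= d.
  by apply: le_trans (xd 0%N); rewrite expr0 mulr1 normc_ge0.
rewrite /l2n /decay_const -[d]ger0_norm // -sqrtr_sqr -sqrtrM ?sqr_ge0 //.
exact: ler_wsqrtr.
Qed.

End L2Facts.

(** * Orbits of a common vector: necessity *)

Section Necessity.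
Variable R : realType.
Implicit Types (x : l2 R) (lambda : R[i]) (r s : R).

Definition spike : nat -> R[i] := fun k => if k == 0%N then 2 else 0.

Lemma spike_l2 : spike \in @l2_pred R.
Proof.
apply: (@decay_l2 _ _ 2 2) => [|k]; first by rewrite ltr1n.
rewrite /spike; case: eqP => [->|_]; first by rewrite expr0 mulr1 normc_nat.
by rewrite ComplexField.Normc.normc0 mul0r.
Qed.

(** The trace on the coordinates of [x] of the visits of the orbit to the unit
    ball around [2 e_0]; only the modulus of the multiple of the shift enters. *)
Definition peaks x r : set nat :=
  [set n | 1 < normc (x n) * r ^+ n < 3 /\
           forall m, (n < m)%N -> normc (x m) * r ^+ n < 1].

Lemma FHC_peaks lambda x : FHC R (lambda \*: @backward_shift R) x ->
  exists c, dense_at_rate (peaks x (normc lambda)) c.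
Proof.
pose v := L2 spike_l2.
have ball0 (w : l2 R) : l2n (w - w) < 1.
  by rewrite subrr -ltcR -l2_normE normr0 ltr01.
move=> /(_ _ (@l2_ball_open R v 1)) /= H.
have /lower_density_gt0P[c Hc] := H (ex_intro _ v (ball0 v)).
exists c; apply: dense_at_rate_sub Hc => n /= nv.
have le1 k := le_lt_trans (normc_le_l2n _ k) nv.
have coordE k : (iter n (lambda \*: @backward_shift R) x - v) k
    = lambda ^+ n * x (n + k)%N - spike k by rewrite -iter_shiftE.
split.
- have := le1 0%N; rewrite coordE addn0 /spike /= => le0.
  have eN : normc (x n) * normc lambda ^+ n = normc (lambda ^+ n * x n).
    by rewrite ComplexField.Normc.normcM normcX mulrC.
  have := le_normcD (lambda ^+ n * x n - 2) 2; rewrite subrK normc_nat.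
  have := le_normcD (2 - lambda ^+ n * x n) (lambda ^+ n * x n).
  rewrite subrK normc_nat -(normcN (2 - _)) opprB eN => h1 h2.
  by apply/andP; split; lra.
- move=> m nm; have := le1 (m - n)%N; rewrite coordE subnKC 1?ltnW //.
  rewrite /spike; case: eqP => [|_]; first by lia.
  by rewrite subr0 ComplexField.Normc.normcM normcX mulrC.
Qed.

(** The coordinate [x m] is smaller than [s ^- n] because [m] comes after the
    peak [n], and larger than [r ^- m] because [m] is a peak. *)
Lemma peaks_order x r s n m : (n < m)%N ->
  peaks x s n -> peaks x r m -> s ^+ n < r ^+ m.
Proof.
move=> nm [_ /(_ _ nm) h1] [/andP[h2 _] _].
have := lt_trans h1 h2; have := normc_ge0 (x m).
rewrite le_eqVlt => /orP[/eqP <-|x0]; first by rewrite !mul0r ltxx.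
by rewrite ltr_pM2l.
Qed.

Lemma peaks_gt1 x r c : 0 <= r -> dense_at_rate (peaks x r) c -> 1 < r.
Proof.
move=> r0 /dense_at_rate_windows[k [T0 [k0 T00 H]]].
have [n /andP[n1 _] pn] := H T0 (leqnn _).
have [m /andP[m1 _] pm] := H n (ltnW n1).
have := peaks_order m1 pn pm; rewrite ltNge; apply: contraNT; rewrite -leNgt => r1.
by apply: ler_wiXn2l => //; exact: ltnW.
Qed.

(** Only the peaks for [r] recur within a known factor.  The first bound follows
    a peak for [s] by the next peak for [r]; the second one takes a large peak
    for [s] and the peak for [r] preceding it. *)
Lemma peaks_moduli_close x r s k T0 c : 1 < r -> 1 < s -> (0 < k)%N ->
  (forall T, (T0 <= T)%N -> exists2 m, (T < m <= k * T)%N & peaks x r m) ->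
  dense_at_rate (peaks x s) c ->
  s <= r ^+ k /\ r <= s ^+ k.
Proof.
move=> r1 s1 k0 H /dense_at_rate_windows[k' [T1 [k'0 T10 H']]]; split.
- have [n /andP[n1 _] pn] := H' (T0 + T1)%N (leq_addl _ _).
  have [|m /andP[m1 m2] pm] := H n; first by lia.
  have := peaks_order m1 pn pm; rewrite ltNge; apply: contraNT; rewrite -ltNge => ks.
  apply: (@le_trans _ _ (r ^+ (k * n))); first by rewrite ler_eXn2l.
  by rewrite exprM lerXn2r ?nnegrE ?exprn_ge0 ?ltW // ?(lt_trans _ r1) ?(lt_trans _ s1).
- have [m /andP[m1 _] pm] := H' (k * T0 + T1)%N (leq_addl _ _).
  have mk : (m.-1 = m.-1 %/ k * k + m.-1 %% k)%N := divn_eq _ _.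
  have mk' := ltn_pmod m.-1 k0.
  have [|n /andP[n1 n2] pn] := H (m.-1 %/ k)%N.
    by rewrite leq_divRL // mulnC; lia.
  have nm : (n < m)%N by lia.
  have mn : (m <= k * n)%N.
    by apply: (@leq_trans (k * (m.-1 %/ k).+1)%N); [lia|rewrite leq_mul2l n1 orbT].
  have := peaks_order nm pn pm; rewrite ltNge; apply: contraNT; rewrite -ltNge => ks.
  apply: (@le_trans _ _ (s ^+ (k * n))); first by rewrite ler_eXn2l.
  by rewrite exprM lerXn2r ?nnegrE ?exprn_ge0 ?ltW // ?(lt_trans _ r1) ?(lt_trans _ s1).
Qed.

(** At a common peak the two quantities [|x n| r ^+ n] and [|x n| s ^+ n] lie
    between 1 and 3, so that [(s / r) ^+ n < 3]. *)
Lemma peaks_disjoint x r s : 0 < r -> r < s ->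
  exists M, forall n, (M <= n)%N -> ~ (peaks x r n /\ peaks x s n).
Proof.
move=> r0 rs; exists (Num.truncn (2 * r / (s - r))).+1 => n Mn [[/andP[h1 _] _] [/andP[_ h2] _]].
have nsr : 2 * r < n%:R * (s - r).
  rewrite -ltr_pdivrMr ?subr_gt0 //; apply: lt_le_trans (truncnS_gt _) _.
  by rewrite ler_nat.
have e0 : 0 <= s / r - 1 by rewrite subr_ge0 ler_pdivlMr // mul1r ltW.
have ber : 1 + n%:R * (s / r - 1) <= (s / r) ^+ n.
  by have := bernoulli n e0; rewrite (addrC 1 (s / r - 1)) subrK.
have : 3 < (s / r) ^+ n.
  apply: lt_le_trans ber.
  rewrite -ltrBlDl (_ : s / r - 1 = (s - r) / r); last by field; rewrite gt_eqF.
  by rewrite mulrA ltr_pdivlMr // (_ : 3 - 1 = 2 :> R) //; lra.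
rewrite expr_div_n ltr_pdivlMr ?exprn_gt0 // => h3.
have x0 : 0 <= normc (x n) := normc_ge0 _.
have : normc (x n) * (3 * r ^+ n) <= normc (x n) * s ^+ n by rewrite ler_wpM2l // ltW.
by rewrite mulrCA; lra.
Qed.

(** Double counting of the peaks up to [T]: beyond some [M] an integer is a peak
    for at most one of the radii, so the total is at most [T] up to a constant,
    and it is at least [size rs] times [T / c]. *)
Lemma size_peaks x c (rs : seq R) : uniq rs ->
  (forall r, r \in rs -> 0 < r /\ dense_at_rate (peaks x r) c) ->
  (size rs <= c)%N.
Proof.
move=> urs H.
have [M HM] : exists M, forall n, (M <= n)%N -> forall r s,
    r \in rs -> s \in rs -> peaks x r n -> peaks x s n -> r = s.
  have /choice[f Hf] : forall p : R * R, exists M, p.1 \in rs -> p.2 \in rs ->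
      p.1 != p.2 -> forall n, (M <= n)%N -> ~ (peaks x p.1 n /\ peaks x p.2 n).
    move=> [r s] /=.
    have [rrs|] := boolP (r \in rs); last by exists 0%N.
    have [srs|] := boolP (s \in rs); last by exists 0%N.
    have [r0 _] := H _ rrs; have [s0 _] := H _ srs.
    have [sr|rs'|rs'] := ltgtP r s; last by exists 0%N; rewrite rs'.
    - by have [M HM] := @peaks_disjoint x _ _ r0 sr; exists M.
    - have [M HM] := @peaks_disjoint x _ _ s0 rs'.
      by exists M => _ _ _ n /HM h [? ?]; apply: h.
  exists (\sum_(r <- rs) \sum_(s <- rs) f (r, s))%N => n Mn r s rrs srs pr ps.
  apply/eqP/negPn/negP => ne.
  have le_f : (f (r, s) <= n)%N.
    apply: leq_trans Mn; rewrite (bigD1_seq r) //= (bigD1_seq s) //=.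
    by rewrite -addnA leq_addr.
  exact: (Hf (r, s) rrs srs ne n le_f (conj pr ps)).
have [T0 HT0] : exists T0, forall T, (T0 <= T)%N -> forall r, r \in rs ->
    (T.+1 <= c * hits (peaks x r) T)%N.
  have /choice[f Hf] : forall r, exists T0, r \in rs -> forall T, (T0 <= T)%N ->
      (T.+1 <= c * hits (peaks x r) T)%N.
    move=> r; have [rrs|] := boolP (r \in rs); last by exists 0%N.
    by have [_ [T0 HT]] := H _ rrs; exists T0.
  exists (\sum_(r <- rs) f r)%N => T leT r rrs; apply: Hf => //.
  by apply: leq_trans leT; rewrite (bigD1_seq r) //= leq_addr.
have lower T : (T0 <= T)%N ->
    (size rs * T.+1 <= c * \sum_(r <- rs) hits (peaks x r) T)%N.
  move=> leT; rewrite (_ : (size rs * T.+1 = \sum_(r <- rs) T.+1)%N); last first.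
    by rewrite big_const_seq count_predT iter_addn_0 mulnC.
  rewrite big_distrr /=.
  by rewrite big_seq [leqRHS]big_seq; apply: leq_sum => r; exact: HT0.
have upper T : (\sum_(r <- rs) hits (peaks x r) T <= M * size rs + T.+1)%N.
  rewrite /hits exchange_big /=.
  rewrite -(big_mkord xpredT (fun k => \sum_(r <- rs) nat_of_bool `[< peaks x r k >]))%N.
  apply: (@leq_trans (\sum_(0 <= k < T.+1) ((k < M) * size rs + 1)))%N.
    apply: leq_sum => k _; have [kM|Mk] := ltnP k M.
      rewrite mul1n; apply: leq_trans (leq_addr _ _).
      by rewrite -sum1_size; apply: leq_sum => r _; case: `[< _ >].
    rewrite mul0n add0n.
    have [/hasP[r rrs /asboolP pr]|/hasPn no] :=
        boolP (has (fun r => `[< peaks x r k >]) rs).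
      rewrite (bigD1_seq r) //= asboolT // big_seq_cond big1 // => s /andP[srs sr].
      apply/eqP; rewrite eqb0; apply/asboolPn => ps; move/eqP: sr; apply.
      exact: HM ps pr.
    by rewrite big_seq big1 // => r /no; rewrite -eqb0 => /eqP.
  rewrite big_split /= sum_nat_const_nat subn0 muln1 leq_add2r.
  rewrite -big_distrl /= leq_mul2r; apply/orP; right.
  have le1 t : (\sum_(0 <= k < t) (k < M) <= t)%N.
    rewrite -[leqRHS]subn0 -[leqRHS]muln1 -sum_nat_const_nat.
    by apply: leq_sum => k _; case: (k < M)%N.
  have [TM|MT] := leqP T.+1 M; first exact: leq_trans (le1 _) TM.
  rewrite (@big_cat_nat _ _ _ M) ?(ltnW MT) //= [X in (_ + X)%N]big_nat.
  rewrite [X in (_ + X)%N]big1 ?addn0 // => k /andP[Mk _].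
  by rewrite ltnNge Mk.
rewrite leqNgt; apply/negP => crs.
have := lower (T0 + c * (M * size rs))%N (leq_addr _ _).
have := leq_mul (leqnn c) (upper (T0 + c * (M * size rs)))%N.
move=> h1 h2; have := leq_trans h2 h1.
rewrite mulnDr => h3; have := leq_mul crs (leqnn (T0 + c * (M * size rs)).+1).
by lia.
Qed.

(** The radii split according to the rate [c], and each class is finite. *)
Lemma countable_peaks x (S : set R) :
  (forall r, S r -> 0 < r /\ exists c, dense_at_rate (peaks x r) c) ->
  countable S.
Proof.
move=> HS; apply: (@sub_countable _ _ _
    (\bigcup_(c in [set: nat]) [set r | S r /\ dense_at_rate (peaks x r) c])).
  by apply: subset_card_le => r Sr; have [_ [c hc]] := HS r Sr; exists c.
apply: bigcup_countable => // c _; apply: finite_set_countable.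
apply: contrapT => /(infinite_set_fset c.+1)[B BS].
apply/negP; rewrite -ltnNge ltnS; apply: (@size_peaks x) => [|r rB].
  exact: finmap.fset_uniq.
by have [Sr dr] := BS r rB; have [] := HS r Sr.
Qed.

Lemma peaks_relatively_compact x (S : set R) : S !=set0 ->
  (forall r, S r -> 1 < r /\ exists c, dense_at_rate (peaks x r) c) ->
  @relatively_compact_in R `]1, +oo[ S.
Proof.
move=> [r Sr] HS; have [r1 [c rc]] := HS r Sr.
have [k [T0 [k0 _ Hk]]] := dense_at_rate_windows rc.
have [a a1 ak] := root_gt1 k0 r1.
have Sab : closure S `<=` `[a, r ^+ k].
  rewrite closureE.
  apply: smallest_sub; first exact: interval_closed.
  move=> s Ss; have [s1 [c' sc]] := HS s Ss.
  have [le_s le_r] := peaks_moduli_close r1 s1 k0 Hk sc.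
  rewrite /= in_itv /= le_s andbT.
  have an : a \is Num.nneg by rewrite nnegrE ltW // (lt_trans ltr01).
  have sn : s \is Num.nneg by rewrite nnegrE ltW // (lt_trans ltr01).
  by rewrite -(ler_pXn2r k0 an sn) ak.
split.
  by apply: subclosed_compact Sab; [exact: closed_closure|exact: segment_compact].
by move=> s /Sab /=; rewrite !in_itv /= andbT => /andP[+ _]; exact: lt_le_trans.
Qed.

End Necessity.

(** * Simultaneous approximation of phases *)

Section RationalPhases.
Variable R : realType.
Implicit Types (u w : R[i]) (s : seq (rat * rat)).

(** Rational real and imaginary parts keep the set of patterns countable. *)
Definition ratc (c : rat * rat) : R[i] := (ratr c.1 +i* ratr c.2)%C.

Lemma ratc0 : ratc (0, 0) = 0.
Proof. by rewrite /ratc /= rmorph0. Qed.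

Lemma ratc_dense w (e : R) : 0 < e -> exists c, normc (ratc c - w) < e.
Proof.
case: w => a b e0.
have dense (t : R) : exists x, `|ratr x - t| < e / 2.
  have [|x] := @rat_in_itvoo _ (t - e / 2) (t + e / 2); first by lra.
  by rewrite in_itv /= => /andP[h1 h2]; exists x; rewrite ltr_norml; lra.
have [x hx] := dense a; have [y hy] := dense b.
exists (x, y); apply: le_lt_trans (normc_le_ReIm _ _) _.
by rewrite /=; lra.
Qed.

Lemma circle_net (e : R) : 0 < e -> exists s, forall w, normc w = 1 ->
  exists2 i, (i < size s)%N & normc (w - ratc (nth (0, 0) s i)) <= e.
Proof.
move=> e0; pose K := (Num.truncn (2 / e)).+1.
have K0 : 0 < K%:R :> R by rewrite ltr0n.
have K2 : 2 / K%:R < e.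
  rewrite ltr_pdivrMr // mulrC -ltr_pdivrMr //; exact: truncnS_gt.
pose g (a : nat) : rat := a%:R / K%:R - 1.
have gE a : ratr (g a) = a%:R / K%:R - 1 :> R.
  by rewrite /g rmorphB rmorph1 fmorph_div !rmorph_nat.
exists [seq (g a, g b) | a <- iota 0 (2 * K).+1, b <- iota 0 (2 * K).+1].
move=> [a b] ab1.
have near_grid (t : R) : `|t| <= 1 -> exists2 x, x \in iota 0 (2 * K).+1 &
    `|t - ratr (g x)| <= 1 / K%:R.
  rewrite ler_norml => /andP[t1 t2].
  have Kt : 0 <= K%:R * (t + 1) by rewrite mulr_ge0 //; lra.
  have /andP[h1 h2] := truncn_itv Kt; exists (Num.truncn (K%:R * (t + 1))).
    rewrite mem_iota /= add0n ltnS -(ler_nat R); apply: le_trans h1 _.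
    by rewrite natrM (mulrC 2) ler_wpM2l ?(ltW K0) //; lra.
  rewrite gE ler_norml; set x := (Num.truncn _)%:R in h1 h2 *.
  rewrite -natr1 in h2.
  have -> : t - (x / K%:R - 1) = (K%:R * (t + 1) - x) / K%:R.
    by field; rewrite gt_eqF.
  by rewrite -mulNr !ler_pM2r ?invr_gt0 //; apply/andP; split; lra.
have le1 : `|a| <= 1 /\ `|b| <= 1.
  have : a ^+ 2 + b ^+ 2 = 1.
    by rewrite -[LHS]sqr_sqrtr ?addr_ge0 ?sqr_ge0 // -/(normc (a +i* b)%C) ab1 expr1n.
  have := sqr_ge0 a; have := sqr_ge0 b => ha hb hab.
  have aux (t : R) : t ^+ 2 <= 1 -> `|t| <= 1.
    by rewrite expr2 => t1; rewrite ler_norml; nra.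
  by split; apply: aux; lra.
have [x xi hx] := near_grid a le1.1; have [y yi hy] := near_grid b le1.2.
set G := [seq _ | _ <- _, _ <- _].
have xyG : (g x, g y) \in G by apply/allpairsP; exists (x, y).
exists (index (g x, g y) G); first by rewrite index_mem.
rewrite nth_index //; apply: le_trans (normc_le_ReIm _ _) _.
rewrite /=; lra.
Qed.

(** Pigeonhole on a finite net of the circle, with a number of powers of [u]
    that does not depend on [u]. *)
Lemma unimodular_recurrence (e : R) : 0 < e -> exists J, forall u, normc u = 1 ->
  exists2 q, (0 < q <= J)%N & normc (u ^+ q - 1) <= e.
Proof.
move=> e0; have e20 : 0 < e / 2 by rewrite divr_gt0.
have [s Hs] := circle_net e20; exists (size s) => u u1.
have /choice[f Hf] : forall i : 'I_(size s).+1, exists k : 'I_(size s),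
    normc (u ^+ i - ratc (nth (0, 0) s k)) <= e / 2.
  by move=> i; have [k ks Hk] := Hs _ (normc_pow1 i u1); exists (Ordinal ks).
have /injectivePn[i1 [i2 ne eqf]] : ~~ injectiveb f.
  apply/injectiveP => /leq_card; rewrite !card_ord; by rewrite ltnn.
wlog i12 : i1 i2 ne eqf / (i1 < i2)%N.
  move=> W; have [|lt|/val_inj eq] := ltngtP i1 i2; first exact: W.
    by apply: (W i2 i1) => //; rewrite eq_sym.
  by rewrite eq eqxx in ne.
exists (i2 - i1)%N; first by have := ltn_ord i2; lia.
have -> : normc (u ^+ (i2 - i1) - 1) = normc (u ^+ i2 - u ^+ i1).
  rewrite -[in RHS](subnK (ltnW i12)) exprD -[X in _ * _ - X]mul1r -mulrBl.
  by rewrite ComplexField.Normc.normcM (normc_pow1 i1 u1) mulr1.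
have := le_normcD (u ^+ i2 - ratc (nth (0, 0) s (f i2)))
                  (ratc (nth (0, 0) s (f i1)) - u ^+ i1).
rewrite [X in normc X <= _](_ : _ = u ^+ i2 - u ^+ i1); last first.
  by rewrite eqf addrA subrK.
by have := Hf i1; have := Hf i2; rewrite (normcB (u ^+ i1)); lra.
Qed.

(** The list contains, for every step [q <= J], all the points of a net of the
    circle at positions in arithmetic progression of step [q].  For the step
    with [u ^+ q] close to 1, the product [w * u ^+ l] hardly moves along the
    progression, while the entries of the list go through the whole net. *)
Lemma phase_word (e : R) : 0 < e -> exists s, (0 < size s)%N /\
  forall u w, normc u = 1 -> normc w = 1 ->
  exists2 l, (l < size s)%N & normc (w * u ^+ l * ratc (nth (0, 0) s l) - 1) <= e.
Proof.
move=> e0; have e20 : 0 < e / 2 by rewrite divr_gt0.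
have [G HG] := circle_net e20.
have G0 : (0 < size G)%N.
  by have [i iG _] := HG 1 (ComplexField.Normc.normc1 R); apply: leq_ltn_trans iG.
have eG0 : 0 < e / 2 / (size G)%:R by rewrite divr_gt0 // ltr0n.
have [J HJ] := unimodular_recurrence eG0.
pose W := (J * size G).+1.
(* The block number [m %/ W] is the step, and entries are constant on runs of
   that length: position [q * i] of block [q] carries the [i]-th net point. *)
pose F m := nth (0, 0) G ((m %% W) %/ (m %/ W)).
exists (mkseq F (J.+1 * W)); rewrite size_mkseq; split=> // u w u1 w1.
have [q /andP[q0 qJ] uq] := HJ u u1.
pose w0 := w * u ^+ (q * W); have w01 : normc w0 = 1.
  by rewrite ComplexField.Normc.normcM w1 (normc_pow1 _ u1) mulr1.
(* The net point is chosen to compensate the rotation at the start of block [q]. *)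
have [|i iG Hi] := HG w0^-1; first by rewrite ComplexField.Normc.normcV w01 invr1.
have qiW : (q * i < W)%N by rewrite ltnS leq_mul // ltnW.
have lW : (q * W + q * i < J.+1 * W)%N.
  by apply: (@leq_trans (q * W + W)%N); [lia|rewrite -mulSnr leq_mul2r; lia].
exists (q * W + q * i)%N => //; rewrite nth_mkseq // /F.
rewrite divnMDl // (divn_small qiW) addn0 modnMDl (modn_small qiW) mulKn //.
set g := ratc _ in Hi *.
have w00 : w0 != 0.
  apply/eqP => w00; move: w01; rewrite w00 ComplexField.Normc.normc0 => /eqP.
  by rewrite eq_sym oner_eq0.
have -> : w * u ^+ (q * W + q * i) * g - 1 =
    (u ^+ q) ^+ i * (w0 * (g - w0^-1)) + ((u ^+ q) ^+ i - 1).
  have -> : w0 * (g - w0^-1) = w0 * g - 1 by rewrite mulrBr mulfV.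
  rewrite (mulrBr ((u ^+ q) ^+ i)) mulr1 addrA subrK /w0 exprD (exprM u q i).
  by congr (_ - _); ring.
apply: le_trans (le_normcD _ _) _.
rewrite (ComplexField.Normc.normcM (_ ^+ i)) (ComplexField.Normc.normcM w0).
rewrite w01 (normc_pow1 _ (normc_pow1 _ u1)) !mul1r.
have := normc_pow_sub1 i (normc_pow1 q u1); rewrite normcB in Hi.
have : i%:R * normc (u ^+ q - 1) <= (size G)%:R * (e / 2 / (size G)%:R).
  by apply: ler_pM => //; [exact: normc_ge0|rewrite ler_nat ltnW].
rewrite [X in _ <= X](_ : _ = e / 2); first lra.
by rewrite mulrC divfK // pnatr_eq0 -lt0n.
Qed.

End RationalPhases.

(** * Finite rational targets and their repetition *)

Section FinitePatterns.
Variable R : realType.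
Implicit Types (fs ys : seq (rat * rat)).

Definition finvec ys : nat -> R[i] := fun k => ratc R (nth (0, 0) ys k).

Lemma finvec_over ys k : (size ys <= k)%N -> finvec ys k = 0.
Proof. by move=> h; rewrite /finvec nth_default // ratc0. Qed.

Lemma finvec_bounded ys (w : nat -> R) : (forall k, 0 <= w k) ->
  exists2 K, 0 <= K & forall k, normc (finvec ys k) * w k <= K.
Proof.
move=> w0; exists (\sum_(k < size ys) normc (finvec ys k) * w k).
  by apply: sumr_ge0 => k _; rewrite mulr_ge0 ?normc_ge0.
move=> k; have [h|h] := leqP (size ys) k.
  rewrite finvec_over // ComplexField.Normc.normc0 mul0r.
  by apply: sumr_ge0 => i _; rewrite mulr_ge0 ?normc_ge0.
rewrite (bigD1 (Ordinal h)) //= lerDl.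
by apply: sumr_ge0 => i _; rewrite mulr_ge0 ?normc_ge0.
Qed.

Lemma finvec_l2 ys : finvec ys \in @l2_pred R.
Proof.
have [|K _ HK] := @finvec_bounded ys (fun k => 2 ^+ k).
  by move=> k; rewrite exprn_ge0.
by apply: (@decay_l2 _ _ 2 K) => //; rewrite ltr1n.
Qed.

Definition finl2 ys : l2 R := L2 (finvec_l2 ys).

(** Cut off a small tail and approximate the remaining coordinates. *)
Lemma finl2_dense (v : l2 R) (e : R) : 0 < e -> exists ys, l2n (finl2 ys - v) < e.
Proof.
move=> e0; have /l2_predP cv := l2_valP v.
pose d := e ^+ 2 / 4; have d0 : 0 < d by rewrite divr_gt0 // exprn_gt0.
have [M HM] : exists M, l2_sum v - series (sq_terms v) M <= d.
  have /cvgrPdist_le /(_ _ d0)[M _ HM] := cv; exists M.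
  by apply: le_trans (HM M (leqnn _)); exact: ler_norm.
have e10 : 0 < Num.min 1 (d / M.+1%:R) by rewrite lt_min ltr01 divr_gt0.
have /choice[f Hf] := fun k => ratc_dense (v k) e10.
exists (mkseq f M); set y := finl2 _ - v.
have yE k : sq_terms y k = normc (finvec (mkseq f M) k - v k) ^+ 2 by [].
have Md : M%:R * (d / M.+1%:R) <= d.
  by rewrite mulrCA ler_piMr ?(ltW d0) // ler_pdivrMr // mul1r ler_nat.
have part n : series (sq_terms y) n <= d + d.
  have : series (sq_terms y) (M + n)%N <= d + d.
    rewrite /series /= (@big_cat_nat _ _ _ M) ?leq_addr //=.
    apply: lerD.
      apply: le_trans Md; rewrite mulr_natl -[X in _ *+ X]subn0 -sumr_const_nat.
      rewrite big_nat [leRHS]big_nat; apply: ler_sum => k /= kM.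
      rewrite yE /finvec nth_mkseq //.
      have := Hf k; rewrite lt_min => /andP[h1 h2].
      by rewrite expr2; apply: le_trans (ltW h2); rewrite ler_piMr ?normc_ge0 ?ltW.
    apply: le_trans HM; rewrite lerBrDl.
    have -> : \sum_(M <= k < M + n) sq_terms y k = \sum_(M <= k < M + n) sq_terms v k.
      rewrite big_nat [RHS]big_nat; apply: eq_bigr => k /andP[Mk _].
      by rewrite yE finvec_over ?size_mkseq // sub0r normcN.
    have := nondecreasing_cvgn_le (nd_series_sq v) cv (M + n)%N.
    by rewrite /series /= (@big_cat_nat _ _ _ M) ?leq_addr.
  by apply: le_trans; apply: nd_series_sq; rewrite leq_addl.
have : l2_sum y <= d + d.
  apply: limr_le; first by have /l2_predP := l2_valP y.
  exact: nearW.
move=> hy; rewrite /l2n -[ltRHS]ger0_norm ?(ltW e0) // -sqrtr_sqr.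
rewrite ltr_sqrt ?exprn_gt0 //; apply: le_lt_trans hy _.
have : e ^+ 2 = 4 * d by rewrite /d mulrC divfK.
by lra.
Qed.

(** Copies of [finvec ys], scaled by [r ^- n] and by the successive entries of
    [fs], placed at the multiples [n] of [N]. *)
Definition comb (r : R) N fs ys (m : nat) : R[i] :=
  finvec fs (m %/ N %% size fs) * ((r ^- (N * (m %/ N)))%:C)%C
  * finvec ys (m %% N).

(** The position inside a copy costs at most [r ^+ size ys], so the bound does
    not depend on the spacing [N], which can be chosen afterwards. *)
Lemma comb_bounded (r : R) fs ys : 0 < r -> exists2 K, 0 <= K &
  forall N m, normc (comb r N fs ys m) * r ^+ m <= K.
Proof.
move=> r0; have rn0 k : 0 <= r ^+ k by rewrite exprn_ge0 // ltW.
have [F F0 HF] := finvec_bounded fs (fun _ => ler01).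
have [Y Y0 HY] := finvec_bounded ys rn0.
exists (F * Y) => [|N m]; first exact: mulr_ge0.
rewrite /comb !ComplexField.Normc.normcM normc_real.
rewrite ger0_norm ?invr_ge0 //.
have -> : r ^+ m = r ^+ (N * (m %/ N)) * r ^+ (m %% N).
  by rewrite -exprD mulnC -divn_eq.
set a := r ^+ _; have a0 : a != 0 by rewrite expf_neq0 // gt_eqF.
set f := normc _; set y := normc _.
have -> : f * a^-1 * y * (a * r ^+ (m %% N)) = f * 1 * (y * r ^+ (m %% N)).
  by field.
by apply: ler_pM; rewrite ?mulr_ge0 ?normc_ge0 //; [exact: HF|exact: HY].
Qed.

End FinitePatterns.

Section Schedule.

(** Index of the radius, target, phases and spacing. *)
Definition pattern : Type := (nat * seq (rat * rat) * seq (rat * rat) * nat)%type.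

(** The exponent of 2 in [j + 1] takes every value along an arithmetic
    progression, so every pattern returns with bounded gaps. *)
Definition schedule (j : nat) : pattern :=
  odflt (0%N, [::], [::], 0%N) (unpickle (logn 2 j.+1)).

Lemma schedule_recurrent (p : pattern) : exists per, forall J,
  exists2 j, (J <= j < J + per)%N & schedule j = p.
Proof.
pose t := pickle p; exists (2 ^ t.+2)%N => J.
pose i := (J %/ 2 ^ t.+1).+1.
have t0 : (0 < 2 ^ t)%N by rewrite expn_gt0.
have t1 : (0 < 2 ^ t.+1)%N by rewrite expn_gt0.
have h1 := divn_eq J (2 ^ t.+1); have h2 := ltn_pmod J t1.
have e1 : (2 ^ t.+1 = 2 * 2 ^ t)%N by rewrite expnS.
have e2 : (2 ^ t.+2 = 4 * 2 ^ t)%N by rewrite !expnS mulnA.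
have j1 : (0 < 2 ^ t * (2 * i).+1)%N by rewrite muln_gt0 t0.
exists (2 ^ t * (2 * i).+1).-1.
  have e3 : (2 ^ t * (2 * i).+1 = J %/ 2 ^ t.+1 * 2 ^ t.+1 + 3 * 2 ^ t)%N.
    by rewrite /i e1 -addn1 -[_.+1 in LHS]addn1; ring.
  clearbody i; move: h1 h2 e3; rewrite e2 e1; move: (_ * (2 * _))%N => a.
  by move: (2 ^ t)%N t0 j1 => b; move: (b * _)%N => c; lia.
rewrite /schedule prednK // lognM // pfactorK // logn_coprime ?addn0.
  by rewrite /t pickleK.
by rewrite coprime2n -addn1 oddD oddM.
Qed.

End Schedule.

(** * The common vector *)

Section CommonVector.
Variable R : realType.
Variables (rr : nat -> R) (q : R) (E : nat).
Hypothesis q_gt1 : 1 < q.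
Hypothesis rr_ge : forall k, q ^+ 3 <= rr k.
Hypothesis rr_le : forall k, rr k <= q ^+ E.

(** A position [n < 2 * D ^ j] and a position [m >= D ^ j.+1] satisfy [E * n <= m],
    so the growth [rr k ^+ n] is at most [q ^+ m]. *)
Let D := (2 * E).+2.

Let D_gt1 : (1 < D)%N. Proof. by []. Qed.

Definition pat_radius (p : pattern) : R := rr p.1.1.1.

Definition pat_comb (p : pattern) (m : nat) : R[i] :=
  comb (pat_radius p) p.2 p.1.2 p.1.1.2 m.

(** The last condition silences a pattern on the first intervals, until its
    constant is absorbed by [q ^+ (D ^ j)]; this gives all the patterns a common
    rate of decay. *)
Definition active (j m : nat) : bool :=
  [&& (D ^ j <= m)%N, (m < 2 * D ^ j)%N &
   `[< forall i, normc (pat_comb (schedule j) i) * pat_radius (schedule j) ^+ i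
                  <= q ^+ (D ^ j) >]].

Definition common_seq (m : nat) : R[i] :=
  let j := trunc_log D m in
  if active j m then pat_comb (schedule j) m else 0.

Lemma radius_gt0 k : 0 < rr k.
Proof. by apply: lt_le_trans (rr_ge k); rewrite exprn_gt0 // (lt_trans ltr01). Qed.

Lemma q_ge0 : 0 <= q. Proof. by rewrite ltW // (lt_trans ltr01). Qed.

(** Of the three factors [q ^+ m] provided by [rr k ^+ m], one pays for the
    constant of the pattern. *)
Lemma common_seq_decay m : normc (common_seq m) * q ^+ (2 * m) <= 1.
Proof.
rewrite /common_seq; set j := trunc_log D m; case: ifP => [|_]; last first.
  by rewrite ComplexField.Normc.normc0 mul0r.
move=> /and3P[jm _ /asboolP /(_ m) hm].
have qm : 0 < q ^+ m by rewrite exprn_gt0 // (lt_trans ltr01).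
rewrite -(ler_pM2r qm) mul1r -mulrA -exprD.
rewrite (_ : 2 * m + m = 3 * m)%N; last by lia.
apply: le_trans (le_trans hm _); last by rewrite ler_eXn2l.
rewrite ler_wpM2l ?normc_ge0 // exprM lerXn2r ?nnegrE ?exprn_ge0 ?q_ge0 //.
  exact: ltW (radius_gt0 _).
exact: rr_ge.
Qed.

Lemma common_seq_l2 : common_seq \in @l2_pred R.
Proof.
apply: (@decay_l2 _ _ q 1) => // m; apply: le_trans (common_seq_decay m).
by rewrite ler_wpM2l ?normc_ge0 // ler_weXn2l // ?ltW // leq_pmull.
Qed.

Definition common_vector : l2 R := L2 common_seq_l2.

(** The coordinates [i < N] come from the copy that starts at [n] and match the
    target up to the phase; the other coordinates of the same interval belong
    to later copies, damped by [q ^- N]; those of later intervals lie so far to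
    the right that the growth [rr k ^+ n] does not compensate their decay. *)
Lemma hit_estimate k ys fs N (j n l : nat) (lambda u : R[i]) (eps eta K Y : R) :
  schedule j = (k, ys, fs, N) ->
  normc lambda = rr k -> lambda = u * (rr k)%:C%C ->
  (size ys <= N)%N -> (N %| n)%N ->
  (D ^ j <= n)%N -> (n + N <= 2 * D ^ j)%N -> l = (n %/ N %% size fs)%N ->
  (forall m, normc (comb (rr k) N fs ys m) * rr k ^+ m <= K) ->
  K <= q ^+ (D ^ j) -> K <= eta * q ^+ N -> 1 <= eta * q ^+ (D ^ j) ->
  (forall i, normc (finvec R ys i) * q ^+ i <= Y) -> eps * Y <= eta ->
  normc (u ^+ n * finvec R fs l - 1) <= eps ->
  forall i, normc (lambda ^+ n * common_seq (n + i) - finvec R ys i) * q ^+ i <= eta.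
Proof.
move=> sj lk lu sN Nn jn nj -> combK Kj KN ej yY eY Hl i.
set r := rr k in lk lu combK *.
have r0 : 0 < r := radius_gt0 k.
have rq : q ^+ 3 <= r := rr_ge k.
have qi0 m : 0 <= q ^+ m by rewrite exprn_ge0 // q_ge0.
have qp m : 0 < q ^+ m by rewrite exprn_gt0 // (lt_trans ltr01).
have K0 : 0 <= K by apply: le_trans (combK 0%N); rewrite expr0 mulr1 normc_ge0.
have eta0 : 0 <= eta.
  by rewrite -(pmulr_lge0 _ (qp (D ^ j)%N)) (le_trans ler01).
have lamE : lambda ^+ n = u ^+ n * ((r ^+ n)%:C)%C.
  by rewrite lu exprMn -rmorphXn.
have [iN|Ni] := ltnP i N.
- have tj : trunc_log D (n + i) = j.
    apply: trunc_log_eq => //; rewrite (leq_trans jn) ?leq_addr //=.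
    apply: (@leq_trans (2 * D ^ j)%N); first by apply: leq_trans nj; rewrite ltn_add2l.
    by rewrite expnS leq_mul2r D_gt1 orbT.
  have act : active j (n + i).
    apply/and3P; split; [by rewrite (leq_trans jn) ?leq_addr| |].
      by apply: leq_trans nj; rewrite ltn_add2l.
    apply/asboolP => m; rewrite sj /pat_comb /pat_radius /=.
    exact: le_trans (combK m) Kj.
  have ni : ((n + i) %/ N = n %/ N)%N by rewrite divnDl // (divn_small iN) addn0.
  have nm : ((n + i) %% N = i)%N.
    by rewrite -modnDml (eqP Nn) add0n modn_small.
  rewrite /common_seq tj act /pat_comb /pat_radius sj /= /comb ni nm -/r.
  rewrite (mulnC N) divnK //.
  have -> : lambda ^+ n * (finvec R fs ((n %/ N) %% size fs) * (r ^- n)%:C%C *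
       finvec R ys i) - finvec R ys i =
     (u ^+ n * finvec R fs ((n %/ N) %% size fs) - 1) * finvec R ys i.
    rewrite mulrBl mul1r; congr (_ - _); rewrite lamE.
    set f := finvec R fs _; set y := finvec R ys _.
    have -> : u ^+ n * (r ^+ n)%:C%C * (f * (r ^- n)%:C%C * y) =
       u ^+ n * f * y * ((r ^+ n)%:C%C * (r ^- n)%:C%C) by ring.
    by rewrite -rmorphM /= mulfV ?mulr1 // expf_neq0 // gt_eqF.
  rewrite ComplexField.Normc.normcM -mulrA.
  apply: le_trans eY; apply: ler_pM; rewrite ?normc_ge0 ?mulr_ge0 ?normc_ge0 //.
- rewrite finvec_over ?subr0 ?(leq_trans sN) // ComplexField.Normc.normcM.
  rewrite normcX lk -/r; set m := (n + i)%N.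
  have [tj|tj] := eqVneq (trunc_log D m) j.
  + have hm : normc (common_seq m) * r ^+ m <= K.
      rewrite /common_seq tj; case: ifP => _.
        by rewrite sj /pat_comb /pat_radius /=; exact: combK.
      by rewrite ComplexField.Normc.normc0 mul0r.
    rewrite -(ler_pM2r (qp N)); apply: le_trans (le_trans hm KN).
    set X := normc _; have X0 : 0 <= X := normc_ge0 _.
    have -> : r ^+ n * X * q ^+ i * q ^+ N = X * (r ^+ n * (q ^+ i * q ^+ N)) by ring.
    rewrite ler_wpM2l // /m exprD ler_wpM2l ?exprn_ge0 ?(ltW r0) //.
    rewrite -exprD; apply: (@le_trans _ _ (q ^+ (3 * i))).
      by rewrite ler_eXn2l // mulSn leq_add2l (leq_trans Ni) // leq_pmull.
    by rewrite exprM lerXn2r ?nnegrE // ltW.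
  + have m0 : (0 < m)%N by rewrite (leq_trans _ (leq_trans jn (leq_addr _ _))) // expn_gt0.
    have jt : (j < trunc_log D m)%N.
      rewrite ltn_neqAle eq_sym tj trunc_log_max //.
      exact: leq_trans jn (leq_addr _ _).
    have Dm : (D ^ j.+1 <= m)%N.
      apply: leq_trans (trunc_logP D_gt1 m0); by rewrite leq_exp2l.
    have Em : (E * n <= m)%N.
      apply: leq_trans Dm; rewrite expnS.
      apply: (@leq_trans (E * (2 * D ^ j))%N); first by rewrite leq_mul2l (leq_trans (leq_addr N n) nj) orbT.
      by rewrite mulnA leq_mul2r /D (mulnC E) -addn2 leq_addr orbT.
    have rnm : r ^+ n <= q ^+ m.
      apply: (@le_trans _ _ (q ^+ (E * n))); last by rewrite ler_eXn2l.
      by rewrite exprM lerXn2r ?nnegrE ?qi0 ?(ltW r0) //; exact: rr_le.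
    rewrite -(ler_pM2r (qp n)) -[leLHS]mulrA -exprD (addnC i) -/m.
    apply: (@le_trans _ _ 1); last first.
      by apply: le_trans ej _; rewrite ler_wpM2l // ler_eXn2l.
    apply: le_trans (common_seq_decay m).
    set X := normc _; have X0 : 0 <= X := normc_ge0 _.
    rewrite mul2n -addnn exprD [leRHS]mulrA ler_wpM2r // mulrC ler_wpM2l //.
Qed.

(** The order of the choices matters: the target, then the phases, then the
    constant [K], which is uniform in the spacing, then the spacing, and at last
    the first interval considered.  Each period of the phases yields a visit. *)
Theorem common_vector_FHC k (lambda : R[i]) : normc lambda = rr k ->
  FHC R (lambda \*: @backward_shift R) common_vector.
Proof.
move=> lk U oU [v Uv]; have [e e0 eU] := open_l2_ball oU Uv.
have [ys Hys] := finl2_dense v (divr_gt0 e0 (ltr0n R 2)).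
have r0 := radius_gt0 k.
have q0 : 0 < q by apply: lt_trans q_gt1.
have [Y Y0 HY] := @finvec_bounded R ys (fun i => q ^+ i)
  (fun i => exprn_ge0 i q_ge0).
pose C := decay_const q; have C0 : 0 <= C := decay_const_ge0 q.
pose eta := e / 4 / (C + 1); have C1 : 0 < C + 1 by lra.
have eta0 : 0 < eta by rewrite !divr_gt0.
have etaC : eta * C < e / 2.
  apply: (@le_lt_trans _ _ (eta * (C + 1))); first by rewrite ler_wpM2l ?ltW //; lra.
  by rewrite /eta divfK ?gt_eqF //; lra.
pose eps := eta / (Y + 1); have Y1 : 0 < Y + 1 by lra.
have eps0 : 0 < eps by rewrite divr_gt0.
have epsY : eps * Y <= eta.
  apply: (@le_trans _ _ (eps * (Y + 1))); first by rewrite ler_wpM2l ?ltW //; lra.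
  by rewrite /eps divfK ?gt_eqF.
have [fs [fs0 Hfs]] := @phase_word R _ eps0.
have [K K0 HK] := comb_bounded fs ys r0.
have [N1 HN1] := expr_unbounded (K / eta) q_gt1.
pose N := (N1 + size ys).+1.
have [j0 Hj0] := expr_unbounded (K + 1 / eta) q_gt1.
pose p : pattern := (k, ys, fs, N).
have [per Hper] := schedule_recurrent p.
apply/lower_density_gt0P; pose P := (N * size fs)%N.
apply: (@dense_at_rate_blocks _ P D per j0) => // [|J J0].
  by rewrite muln_gt0 fs0.
have [j /andP[Jj jJ] sj] := Hper J; exists j; first by rewrite Jj.
move=> i i1 i2.
pose u := lambda * ((rr k)^-1)%:C%C.
have lu : lambda = u * (rr k)%:C%C.
  by rewrite /u -mulrA -rmorphM /= mulVf ?mulr1 // gt_eqF.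
have u1 : normc u = 1.
  rewrite ComplexField.Normc.normcM normc_real lk ger0_norm ?invr_ge0 ?(ltW r0) //.
  by rewrite mulfV // gt_eqF.
have [l ls Hl] := Hfs _ _ (normc_pow1 N u1) (normc_pow1 (P * i) u1).
pose n := (P * i + N * l)%N.
have nE : n = (N * (size fs * i + l))%N by rewrite mulnDr mulnA.
have nN : (n + N <= P * i.+1)%N.
  by rewrite /n mulnS -addnA addnC leq_add2r -mulnSr leq_mul2l ls orbT.
have jDj : (j0 <= D ^ j)%N.
  by apply: leq_trans (leq_trans J0 Jj) _; rewrite ltnW // ltn_expl.
have K1 : K + 1 / eta <= q ^+ (D ^ j) by exact: Hj0.
have ie0 : 0 < 1 / eta by rewrite divr_gt0.
exists n; first by rewrite leq_addr /=; apply: leq_trans nN; rewrite -addn1 leq_add2l.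
apply: eU; apply: le_lt_trans (l2n_triangle _ (finl2 R ys) _) _.
suff : l2n (iter n (lambda \*: @backward_shift R) common_vector - finl2 R ys) <= eta * C.
  by move: Hys etaC; lra.
apply: decay_l2n => // a.
have -> : (iter n (lambda \*: @backward_shift R) common_vector - finl2 R ys) a =
  lambda ^+ n * common_seq (n + a) - finvec R ys a.
  by rewrite -[common_seq _]/(common_vector _) -iter_shiftE.
apply: (@hit_estimate k ys fs N j n l lambda u eps eta K Y) => //.
- by rewrite /N leqW // leq_addl.
- by rewrite nE dvdn_mulr.
- by apply: leq_trans i1 (leq_addr _ _).
- exact: leq_trans nN i2.
- by rewrite nE mulKn // mulnC modnMDl modn_small.
- by apply: le_trans K1; lra.
- by rewrite mulrC -ler_pdivrMr //; apply: HN1; rewrite /N leqW // leq_addr.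
- by rewrite mulrC -ler_pdivrMr //; apply: le_trans K1; lra.
- by rewrite /n exprD (exprM u N l).
Qed.

End CommonVector.

(** * The characterization *)

Lemma countable_enum (T : Type) (S : set T) : S !=set0 -> countable S ->
  exists f : nat -> T, (forall k, S (f k)) /\ forall t, S t -> exists k, f k = t.
Proof.
move=> [t0 St0] /countable_injP[g injg].
have /choice[f Hf] : forall k, exists t, S t /\ forall s, S s -> g s = k -> t = s.
  move=> k; have [[t [St gt]]|no] := pselect (exists t, S t /\ g t = k).
    by exists t; split=> // s Ss gs; apply: injg; rewrite ?inE ?gt.
  by exists t0; split=> // s Ss gs; case: no; exists s.
exists f; split=> [k|t St]; first by have [] := Hf k.
by exists (g t); have [_ /(_ t St)] := Hf (g t); apply.
Qed.

Lemma relatively_compact_bounds (R : realType) (S : set R) :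
  @relatively_compact_in R `]1, +oo[ S ->
  exists a b, 1 < a /\ forall r, S r -> a <= r <= b.
Proof.
move=> [cS S1].
have S1' r : S r -> 1 < r.
  by move=> /subset_closure/S1 /=; rewrite in_itv /= andbT.
have /existsNP[B /not_implyP[B1 SB]] : ~ (forall B, nbhs (1 : R) B -> S `&` B !=set0).
  by move=> /S1 /=; rewrite in_itv /= ltxx.
have /nbhs_ballP[e /= e0 eB] := B1.
have [M [_ HM]] := compact_bounded cS.
exists (1 + e), (M + 1); split=> [|r Sr]; first by rewrite ltrDl.
apply/andP; split.
  rewrite leNgt; apply/negP => re; apply: SB; exists r; split=> //; apply: eB.
  rewrite -ball_normE /= distrC ger0_norm ?subr_ge0 ?ltrBlDl //.
  exact: ltW (S1' _ Sr).
apply: le_trans (ler_norm r) _; apply: (HM (M + 1)); first by rewrite ltrDl.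
exact: subset_closure.
Qed.

Theorem mainTheorem2 (R : realType) (Lambda : set R[i])
    (Lambda_neq0 : Lambda !=set0) :
  \bigcap_(lambda in Lambda) FHC R (lambda \*: @backward_shift R) !=set0 <->
  [/\ countable [set normc lambda | lambda in Lambda],
      @relatively_compact_in R `]1, +oo[ [set normc lambda | lambda in Lambda],
      [set normc lambda | lambda in Lambda] !=set0 &
      [set normc lambda | lambda in Lambda] `<=` `]1, +oo[].
Proof.
set S := [set normc lambda | lambda in Lambda]; split.
- move=> [x Hx]; have S0 : S !=set0.
    by case: Lambda_neq0 => lambda Hl; exists (normc lambda), lambda.
  have HS r : S r -> 1 < r /\ exists c, dense_at_rate (peaks x r) c.
    move=> [lambda Hl <-]; have [c Hc] := FHC_peaks (Hx lambda Hl).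
    by split; [exact: peaks_gt1 (normc_ge0 _) Hc|exists c].
  split=> //.
  + apply: (@countable_peaks _ x) => r /HS[r1 Hr]; split=> //.
    exact: lt_trans r1.
  + exact: peaks_relatively_compact S0 HS.
  + by move=> r /HS[r1 _]; rewrite /= in_itv /= r1.
- move=> [cS rS S0 _].
  have [a [b [a1 Sab]]] := relatively_compact_bounds rS.
  have [rr [rrS rr_onto]] := countable_enum S0 cS.
  have [q q1 qa] := root_gt1 (isT : (0 < 3)%N) a1.
  have [E HE] := expr_unbounded b q1.
  have rr_ge k : q ^+ 3 <= rr k by rewrite qa; have /andP[] := Sab _ (rrS k).
  have rr_le k : rr k <= q ^+ E.
    by apply: le_trans (HE E (leqnn _)); have /andP[] := Sab _ (rrS k).
  exists (common_vector E q1 rr_ge) => lambda Hl.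
  have [k Hk] := rr_onto (normc lambda) (ex_intro2 _ _ lambda Hl erefl).
  exact: (common_vector_FHC q1 rr_ge rr_le (esym Hk)).
Qed.
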